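(* In the setting of the context, let $m_i(U_i)=p$ for all $i=1,\dots,N$ with $p=\alpha/N$, and let $m(\{A=a\})$ denote the $m$-measure of the set of points with avalanche size $a$. Then for each $a$ $$\lim_{\alpha\to 1}\ \lim_{N\to\infty}\ \log\frac{m(\{A=a\})}{m(\{A=a+1\})}=\frac{3}{2a}+o\!\left(\frac1a\right).$$
   Context: Let $N\ge 1$ be an integer. For $i=1,\dots,N$ let $X_i$ be a metric space and $S_i:X_i\to X_i$ a continuous map. Put $X=X_1\times\cdots\times X_N$ and $S=S_1\times\cdots\times S_N$ (the product map). For each $i$ let $U_i\subset X_i$ be an open set that is the top level of a tower of height $n_i+1>N$ for $S_i$: there is a set $B_i\subset X_i$ such that the sets $S_i^k(B_i)$, $k=0,\dots,n_i$, are pairwise disjoint and $S_i^{n_i}(B_i)=U_i$. For each $i$ let $m_i$ be an $S_i$-invariant ergodic probability measure on $X_i$, and let $m=\bigotimes_{i=1}^N m_i$ be the product measure on $X$. Avalanche size: for $x=(x_1,\dots,x_N)\in X$ put $A(x,1)=|\{1\le i\le N: x_i\in U_i\}|$ and, for $k\ge 1$, $$A(x,k+1)=|\{1\le i\le N:\ \exists\, 0\le l\le A(x,k)\text{ with } S_i^l(x_i)\in U_i\}|.$$ The sequence $A(x,k)$ is nondecreasing in $k$ and there is a minimal $k\le N$ with $A(x,k+1)=A(x,k)$; the avalanche size at $x$ is $A(x)=A(x,k)$ for this $k$. Write $\{A=a\}=\{x\in X:A(x)=a\}$. The limit $N\to\infty$ is taken along such systems with $N$ coordinates, and $o(1/a)$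 refers to $a\to\infty$.
   Formalization: Added hypothesis: almost every point of S_i^{-n_i}(U_i) lies in B_i (automatic for injective S_i); without it the claim fails for some noninvertible S_i. The limit α→1 is taken from the left, since such towers force α<1. *)

(* Defs.v *)
(* MathComp / MathComp-Analysis *)
From HB Require Import structures.
From mathcomp Require Import all_boot all_order all_algebra.
From mathcomp Require Import all_classical all_reals all_analysis.

Set Implicit Arguments.
Unset Strict Implicit.
Unset Printing Implicit Defensive.

Import Order.TTheory GRing.Theory Num.Theory.
Import numFieldNormedType.Exports.

Local Open Scope classical_set_scope.
Local Open Scope ring_scope.

(* Measurable types of the library are pointed, so metric spaces are equipped
   with a point; this is no restriction, since each of them will carry a
   probability measure and is therefore nonempty. *)
#[short(type="metricPointedType")]
HB.structure Definition PointedMetric (R : numDomainType) :=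
  {T of Metric R T & Pointed T}.

Definition borelType (R : realType) (X : metricPointedType R) :=
  g_sigma_algebraType (@open X).

Definition prod_generators (R : realType) (N : nat)
    (X : 'I_N -> metricPointedType R) : set (set (forall i, X i)) :=
  \bigcup_i preimage_set_system setT (fun x => x i)
              (measurable : set (set (borelType (X i)))).

Arguments prod_generators {R N} X _.

(* The product of the spaces X_i with the product of their Borel
   sigma-algebras. *)
Definition prodType (R : realType) (N : nat)
    (X : 'I_N -> metricPointedType R) :=
  g_sigma_algebraType (prod_generators X).

Definition invariant (d : measure_display) (T : measurableType d)
    (R : realType) (mu : probability T R) (f : T -> T) :=
  forall A, measurable A -> mu (f @^-1` A) = mu A.

Definition ergodic (d : measure_display) (T : measurableType d)
    (R : realType) (mu : probability T R) (f : T -> T) :=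
  forall A, measurable A -> f @^-1` A = A -> mu A = 0%E \/ mu A = 1%E.

Definition is_product_measure (R : realType) (N : nat)
    (X : 'I_N -> metricPointedType R)
    (mu : forall i, probability (borelType (X i)) R)
    (m : probability (prodType X) R) :=
  forall A : forall i, set (borelType (X i)), (forall i, measurable (A i)) ->
    m [set x | forall i, A i (x i)] = (\prod_(i < N) mu i (A i))%E.

(* U is the top level of a tower of height n.+1 with base B. *)
Definition tower (T : Type) (S : T -> T) (n : nat) (B U : set T) :=
  trivIset [set k | (k <= n)%N] (fun k => iter k S @` B) /\
  iter n S @` B = U.

Record avalanche_system (R : realType) (N : nat) := {
  space : 'I_N -> metricPointedType R ;
  coord_map : forall i, space i -> space i ;
  coord_map_continuous : forall i, continuous (@coord_map i) ;
  top : forall i, set (space i) ;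
  top_open : forall i, open (@top i) ;
  base : forall i, set (space i) ;
  height : 'I_N -> nat ;
  height_gt : forall i, (N < (height i).+1)%N ;
  towerP : forall i,
    tower (@coord_map i) (height i) (@base i) (@top i) ;
  coord_prob : forall i, probability (borelType (space i)) R ;
  coord_prob_invariant : forall i, invariant (@coord_prob i) (@coord_map i) ;
  coord_prob_ergodic : forall i, ergodic (@coord_prob i) (@coord_map i) ;
  prod_prob : probability (prodType space) R ;
  prod_probP : is_product_measure (@coord_prob) prod_prob
}.

Arguments coord_map {R N} _ _ _.
Arguments top {R N} _ _ _.
Arguments base {R N} _ _ _.
Arguments coord_prob {R N} _ _.

(* The base contains almost every point that the n_i-th iterate sends to the
   top level; equivalently, when the base is measurable, the base and the top
   level have the same measure. This holds for every tower of an injective map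
   (lemma injective_saturated), but not for towers of noninvertible maps defined
   by disjointness of the forward images of the base alone: there U_i may return
   to itself in one step with positive probability. *)
Definition tower_saturated (R : realType) (N : nat)
    (s : avalanche_system R N) :=
  forall i, (coord_prob s i).-negligible
    ((iter (height s i) (coord_map s i) @^-1` top s i) `\` base s i).

Lemma injective_saturated (R : realType) (N : nat)
    (s : avalanche_system R N) :
  (forall i, injective (coord_map s i)) -> tower_saturated s.
Proof.
move=> injS i; have [_ topE] := towerP s i.
rewrite [X in _.-negligible X](_ : _ = set0); first exact: negligible_set0.
apply/seteqP; split=> // x [/=]; rewrite -topE => -[b Bb] bx; apply.
suff <- : b = x by [].
by elim: (height s i) bx => //= n IHn /injS.
Qed.

Section avalanche_size.
Context (R : realType) (N : nat) (s : avalanche_system R N).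
Variable x : prodType (space s).

(* [avalanche_step k] is A(x, k + 1). *)
Fixpoint avalanche_step (k : nat) : nat :=
  if k is k'.+1 then
    #|[pred i : 'I_N | `[< exists2 l, (l <= avalanche_step k')%N &
         top s i (iter l (coord_map s i) (x i)) >]]|
  else #|[pred i : 'I_N | `[< top s i (x i) >]]|.

Lemma avalanche_step_le (k : nat) : (avalanche_step k <= N)%N.
Proof. by case: k => [|k] /=; rewrite -[leqRHS]card_ord max_card. Qed.

Lemma avalanche_step_nondecreasing (k : nat) :
  (avalanche_step k <= avalanche_step k.+1)%N.
Proof.
elim: k => [|k IHk] /=; apply: subset_leq_card; apply/fintype.subsetP => i;
  rewrite !unfold_in.
  by move=> /asboolP Ui; apply/asboolP; exists 0.
move=> /asboolP[l lk Ui]; apply/asboolP; exists l => //.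
exact: leq_trans lk IHk.
Qed.

Lemma avalanche_step_stable :
  exists k, avalanche_step k.+1 == avalanche_step k.
Proof.
apply: contrapT => /forallNP neq.
have lt k : (avalanche_step k < avalanche_step k.+1)%N.
  rewrite ltn_neqAle avalanche_step_nondecreasing andbT eq_sym.
  exact/negP/neq.
have ge k : (k <= avalanche_step k)%N.
  by elim: k => // k IHk; exact: leq_ltn_trans IHk (lt k).
by have := leq_trans (ge N.+1) (avalanche_step_le N.+1); rewrite ltnn.
Qed.

Definition avalanche : nat := avalanche_step (ex_minn avalanche_step_stable).

End avalanche_size.

(* m({A = a}) *)
Definition avalanche_prob (R : realType) (N : nat)
    (s : avalanche_system R N) (a : nat) : R :=
  fine (prod_prob s [set x | avalanche x = a]).

(* Main.v *)
Require Import Defs.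
From HB Require Import structures.
From mathcomp Require Import all_boot all_order all_algebra.
From mathcomp Require Import all_classical all_reals all_analysis.
From mathcomp Require Import zify ring lra.

Set Implicit Arguments.
Unset Strict Implicit.
Unset Printing Implicit Defensive.

Import Order.TTheory GRing.Theory Num.Theory.
Import numFieldNormedType.Exports.

Local Open Scope classical_set_scope.
Local Open Scope ring_scope.

(** Let f_i(x) be the first time at which coordinate i of x visits U_i. The
    avalanche size of x is the least fixed point of g(j) = #{i | f_i(x) <= j}
    ([avalanche_fixpoint], [avalanche_le]). Hence A(x) = a exactly when g(a) = a
    and g(j) > j for all j < a ([avalanche_parking]): a coordinates are hit by
    time a, and their hitting times form a parking function.

    Saturation of the towers makes the sets S_i^(-l) U_i, for l <= N, disjoint up
    to null sets ([return_time_negligible]). By invariance each of them has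
    measure p, so a coordinate has first hitting time l with probability p for
    each l <= a, and none of these values with probability 1 - (a + 1) p. The
    coordinates are independent, so m {A = a} is p^a (1 - (a + 1) p)^(N - a) times
    a number of configurations. The cycle lemma gives this number: rotating the
    hitting times modulo a + 1 preserves the number of hits, and each
    configuration with a hits has exactly one rotation that is parking
    ([parking_rotate]). This yields ([avalanche_law_bin])

      m {A = a} = 'C(N, a) (a + 1)^(a - 1) p^a (1 - (a + 1) p)^(N - a).

    With p = alpha / N, the logarithm of m {A = a} / m {A = a + 1} tends to
    a ln ((a + 1) / (a + 2)) + alpha - ln alpha ([cvg_ln_avalanche_ratio]), hence
    to 1 - a ln ((a + 2) / (a + 1)) as alpha tends to 1. Two elementary bounds for
    the logarithm that are exact to second order at 1 show that this is
    3 / (2 a) + O(1 / a^2) ([critical_log_ratio_bound]). *)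

(** * The cycle lemma and the count of parking configurations *)

Section parking.
Local Open Scope nat_scope.

(** [C] is to be read as the partial sums of the numbers of cars on a circle of
    a + 1 spots that carries a cars, so that [C n - n] drops by 1 over each turn.
    A starting point is admissible when this walk does not go below its starting
    level during the a steps that follow. The first minimum of the walk over one
    turn is admissible. Of two admissible points u < v, the second is at least
    as high as the first, but one turn after u the walk has dropped below u and
    v forbids this. *)
Lemma cycle_lemma (a : nat) (C : nat -> nat) :
  (forall n, C (n + a.+1) = C n + a) ->
  exists r : 'I_a.+1, forall r' : 'I_a.+1,
    (forall j, 0 < j <= a -> C r' + j <= C (r' + j)) <-> r' = r.
Proof.
move=> Cper.
(* The quantity C t - t, shifted by a to stay in nat and made lexicographic with
   t, so that its minimum is the first minimum of the walk. *)
have [r _ rmin] := @arg_minnP 'I_a.+1 ord0 predT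
  (fun t => (C t + (a - t)) * a.+1 + t) isT.
have goodr j : 0 < j <= a -> C r + j <= C (r + j).
  move=> /andP[j0 ja].
  have [rja|arj] := leqP (r + j) a.
    have := rmin (Ordinal (rja : r + j < a.+1)) isT => /=.
    nia.
  have tr : r + j - a.+1 < r by have := ltn_ord r; lia.
  have ta : r + j - a.+1 < a.+1 by have := ltn_ord r; lia.
  have := rmin (Ordinal ta) isT => /=.
  have -> : C (r + j) = C (r + j - a.+1) + a by rewrite -Cper subnK.
  have := ltn_ord r.
  move: (C (r + j - a.+1)) (C r) => ct cr.
  nia.
exists r => r'; split=> [goodr'|->//]; apply/val_inj => /=.
have uniq (u v : 'I_a.+1) : u < v ->
    (forall j, 0 < j <= a -> C u + j <= C (u + j)) ->
    (forall j, 0 < j <= a -> C v + j <= C (v + j)) -> False.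
  move=> uv gu gv; have va := ltn_ord v.
  have := gu (v - u); have := gv (u + a.+1 - v).
  have -> : v + (u + a.+1 - v) = u + a.+1 by lia.
  have -> : u + (v - u) = v by lia.
  rewrite Cper; lia.
have [lt|lt|//] := ltngtP r' r.
- by case: (uniq r' r lt).
- by case: (uniq r r' lt).
Qed.

Variables (N a : nat).
Implicit Types f : {ffun 'I_N -> option 'I_a.+1}.

Definition count_upto f (j : nat) : nat :=
  #|[pred i | if f i is Some l then l <= j else false]|.

(** Viewed on the coordinates with a value, these are parking functions of
    length a: the first condition says that there are a of them, the second
    is the ballot condition. *)
Definition parking f : bool :=
  (count_upto f a == a) && [forall j : 'I_a, j < count_upto f j].

Definition rotate (r : 'I_a.+1) f : {ffun 'I_N -> option 'I_a.+1} :=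
  [ffun i => omap (fun l => l - r)%R (f i)].

Lemma rotate_bij r : bijective (rotate r).
Proof.
exists (rotate (- r)%R) => f; apply/ffunP => i; rewrite !ffunE;
  by case: (f i) => //= l; rewrite opprK ?subrK ?addrK.
Qed.

(** The spots are read modulo a + 1, so that [cumul f] is the walk of the cycle
    lemma. *)
Definition fibre f (k : nat) : nat := #|[pred i | f i == Some (inord (k %% a.+1))]|.

Definition cumul f (n : nat) : nat := \sum_(l < n) fibre f l.

Lemma cumulS f n : cumul f n.+1 = cumul f n + fibre f n.
Proof. by rewrite /cumul big_ord_recr. Qed.

Lemma count_uptoE f j : j <= a -> count_upto f j = cumul f j.+1.
Proof.
move=> ja; rewrite /cumul /count_upto -sum1_card.
rewrite (partition_big
  (fun i => (if f i is Some l then inord l else ord0) : 'I_j.+1) predT)//=.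
apply: eq_bigr => k _; rewrite /fibre -sum1_card; apply: eq_bigl => i.
rewrite !inE; case: (f i) => //= l.
have kj := ltn_ord k; rewrite modn_small; last by lia.
apply/andP/eqP => [[lj /eqP <-]|[->]].
  by rewrite inordK ?ltnS//; congr Some; apply/val_inj; rewrite /= inordK.
rewrite inordK; last by lia.
by split; [lia|apply/eqP/val_inj; rewrite /= inordK].
Qed.

Lemma fibre_rotate (r : 'I_a.+1) f k : fibre (rotate r f) k = fibre f (r + k).
Proof.
apply: eq_card => i; rewrite !inE ffunE; case: (f i) => //= l.
apply/eqP/eqP => [[]|[->]].
  move/(congr1 (fun t => t + r)%R); rewrite subrK => ->; congr Some.
  apply/val_inj; rewrite /= !inordK ?ltn_pmod//.
  by rewrite modnDml addnC.
congr Some; apply/eqP; rewrite subr_eq; apply/eqP/val_inj.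
by rewrite /= !inordK ?ltn_pmod// modnDml addnC.
Qed.

Lemma cumul_rotate (r : 'I_a.+1) f n : cumul f r + cumul (rotate r f) n = cumul f (r + n).
Proof.
rewrite /cumul big_split_ord /=; congr addn.
by apply: eq_bigr => i _; rewrite fibre_rotate.
Qed.

Lemma count_upto_rotate r f : count_upto (rotate r f) a = count_upto f a.
Proof.
apply: eq_card => i; rewrite !inE ffunE; case: (f i) => //= l.
by rewrite leq_ord -ltnS ltn_pmod.
Qed.

(** A rotation by r moves the starting point of the walk [cumul f] to r, and
    [parking] is admissibility of the starting point. *)
Lemma parking_rotate f : count_upto f a = a ->
  #|[pred r | parking (rotate r f)]| = 1.
Proof.
move=> fa.
have per n : cumul f (n + a.+1) = cumul f n + a.
  rewrite -[in RHS]fa count_uptoE//.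
  elim: n => [|n IHn]; first by rewrite /cumul big_ord0.
  by rewrite addSn cumulS IHn (cumulS f n) /fibre modnDr addnAC.
have [r rP] := cycle_lemma per.
rewrite -(card1 r); apply: eq_card => r'; rewrite !inE.
have cr j : j <= a -> cumul f r' + count_upto (rotate r' f) j =
    cumul f (r' + j.+1).
  by move=> ja; rewrite count_uptoE// cumul_rotate.
apply/idP/eqP => [/andP[_ /forallP gt]|/rP ge].
  apply/rP => -[//|j] /= ja; have := gt (Ordinal ja).
  by rewrite -(cr j (ltnW ja)) leq_add2l.
rewrite /parking count_upto_rotate fa eqxx; apply/forallP => j.
by have := ge j.+1 (ltn_ord j); rewrite -(cr j (ltnW (ltn_ord j))) leq_add2l.
Qed.

Lemma card_count_upto :
  #|[pred f | count_upto f a == a]| = 'C(N, a) * a.+1 ^ a.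
Proof.
have count_supp f : count_upto f a = #|[set i | f i != None]%SET|.
  by apply: eq_card => i; rewrite !inE; case: (f i) => //= l; rewrite leq_ord.
rewrite -sum1_card (partition_big (fun f => [set i | f i != None]%SET)
  (fun D : {set 'I_N} => #|D| == a)) => [|f]; last by rewrite inE count_supp.
under eq_bigr => D /eqP Da.
  rewrite (_ : \sum_(_ | _) 1 = a.+1 ^ a); last first.
    transitivity (#|predC1 (None : option 'I_a.+1)| ^ #|D|); last first.
      by rewrite cardC1 card_option card_ord Da.
    rewrite -(card_pffun_on None) -sum1_card; apply: eq_bigl => f.
    rewrite inE count_supp; apply/andP/pfamilyP.
      move=> [_ /eqP <-]; split; first by apply/fintype.subsetP => i; rewrite !inE.
      by move=> i; rewrite !inE.
    move=> [/fintype.subsetP fD Df].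
    have supp : [set i | f i != None]%SET = D.
      apply/setP => i; rewrite inE; apply/idP/idP => [fi|iD]; first exact: fD.
      by have := Df i iD; rewrite inE.
    by rewrite supp Da !eqxx.
  over.
rewrite sum_nat_const; congr muln.
rewrite -[N in RHS]card_ord -card_draws; apply: eq_card => D.
by rewrite !inE.
Qed.

(** The a + 1 rotations preserve the number of coordinates with a value, and
    one configuration in each class of a + 1 rotations is parking. *)
Lemma card_parking :
  a.+1 * #|[pred f | parking f]| = 'C(N, a) * a.+1 ^ a.
Proof.
rewrite -card_count_upto -[RHS]sum1_card.
under [RHS]eq_bigr => f /eqP fa do
  rewrite -(parking_rotate fa) -sum1_card big_mkcond /=.
rewrite exchange_big /= -[X in X * _ = _](card_ord a.+1) -sum_nat_const.
apply: eq_bigr => r _; rewrite -sum1_card.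
rewrite -big_mkcondr /= [LHS](reindex (rotate r)) /=; last first.
  exact: onW_bij (rotate_bij r).
apply: eq_bigl => f; rewrite !inE /parking count_upto_rotate.
by case: eqP.
Qed.

End parking.

(** * The avalanche size as a function of the hitting times *)

Section first_hit.
Variable a : nat.

Definition first_hit (P : nat -> Prop) : option 'I_a.+1 :=
  [pick l : 'I_a.+1 | `[< P l /\ forall k, (k < l)%N -> ~ P k >]].

Lemma first_hit_Some (P : nat -> Prop) (l : 'I_a.+1) :
  first_hit P = Some l <-> P l /\ forall k, (k < l)%N -> ~ P k.
Proof.
rewrite /first_hit; case: pickP => [l' /asboolP[Pl' min']|nohit]; last first.
  by split=> // /asboolP; rewrite nohit.
split=> [[<-]//|[Pl min]]; congr Some; apply/val_inj.
have [/min//|/min'//|//] := ltngtP l' l.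
Qed.

Lemma first_hit_le (P : nat -> Prop) (j : nat) : (j <= a)%N ->
  (if first_hit P is Some l then (l <= j)%N else false) =
  `[< exists2 l, (l <= j)%N & P l >].
Proof.
move=> ja; apply/idP/asboolP.
  case E : (first_hit P) => [l|//] lj.
  by move/first_hit_Some : E => [Pl _]; exists l.
move=> [l lj Pl].
have exP : exists k, `[< P k >] by exists l; apply/asboolP.
case: (ex_minnP exP) => k /asboolP Pk kmin.
have kl : (k <= l)%N by apply: kmin; apply/asboolP.
have ka : (k < a.+1)%N by rewrite ltnS (leq_trans kl)// (leq_trans lj).
have -> : first_hit P = Some (Ordinal ka).
  apply/first_hit_Some; split=> // k' kk' /asboolP /kmin.
  by rewrite leqNgt kk'.
exact: leq_trans kl lj.
Qed.

Lemma first_hit_None (P : nat -> Prop) :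
  first_hit P = None <-> forall k, (k <= a)%N -> ~ P k.
Proof.
have := first_hit_le P (leqnn a); case: (first_hit P) => [l|].
  rewrite leq_ord => /esym/asboolP[k ka Pk]; split=> //.
  by move=> /(_ k ka).
move=> /esym/asboolP nohit; split=> // _ k ka Pk; apply: nohit.
by exists k.
Qed.

End first_hit.

Section avalanche_parking.
Context (R : realType) (N : nat) (s : avalanche_system R N).
Variable x : prodType (Defs.space s).

Definition hit_count (j : nat) : nat :=
  #|[pred i : 'I_N | `[< exists2 l, (l <= j)%N &
      top s i (iter l (coord_map s i) (x i)) >]]|.

Lemma hit_count_le j k : (j <= k)%N -> (hit_count j <= hit_count k)%N.
Proof.
move=> jk; apply: subset_leq_card; apply/fintype.subsetP => i.
rewrite !unfold_in => /asboolP[l lj Ul]; apply/asboolP; exists l => //.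
exact: leq_trans jk.
Qed.

(** Together with [avalanche_le], this says that the avalanche size is the least
    fixed point of [hit_count]. *)
Lemma avalanche_fixpoint : hit_count (avalanche x) = avalanche x.
Proof. by rewrite /avalanche; case: ex_minnP => k /eqP. Qed.

Lemma avalanche_le j : (hit_count j <= j)%N -> (avalanche x <= j)%N.
Proof.
move=> hj; rewrite /avalanche; case: ex_minnP => k _ _.
elim: k => [|k IHk]; last exact: leq_trans (hit_count_le IHk) hj.
apply: leq_trans (leq_trans (hit_count_le (leq0n j)) hj).
rewrite [X in (X <= _)%N](_ : _ = hit_count 0)//.
apply: eq_card => i; rewrite !unfold_in /=; apply/asboolP/asboolP.
  by move=> Ui; exists 0%N.
by move=> [[|l]].
Qed.

Definition hitting_code (a : nat) : {ffun 'I_N -> option 'I_a.+1} :=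
  [ffun i => first_hit a (fun l => top s i (iter l (coord_map s i) (x i)))].

(** A number a is the least fixed point of a nondecreasing function g when
    g a = a and g j > j for all j < a. These conditions involve the hitting times
    up to a alone. *)
Lemma avalanche_parking (a : nat) :
  avalanche x = a <-> parking (hitting_code a).
Proof.
have countE j : (j <= a)%N -> count_upto (hitting_code a) j = hit_count j.
  move=> ja; apply: eq_card => i.
  by rewrite !unfold_in ffunE first_hit_le.
rewrite /parking countE//; split=> [aE|/andP[/eqP fixa /forallP gta]].
  rewrite -[in hit_count a]aE avalanche_fixpoint aE eqxx; apply/forallP => j.
  rewrite countE; last exact/ltnW/ltn_ord.
  rewrite ltnNge; apply/negP => /avalanche_le.
  by rewrite aE leqNgt ltn_ord.
apply/eqP; rewrite eqn_leq avalanche_le ?fixa//= leqNgt; apply/negP => lt.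
have := gta (Ordinal lt); rewrite /= countE ?(ltnW lt)//.
by rewrite avalanche_fixpoint ltnn.
Qed.

End avalanche_parking.

(** * The law of the hitting time of one coordinate *)

Section fin_partition.
Context d (T : measurableType d) (R : realType) (mu : {measure set T -> \bar R}).

Lemma measure_preimage_fin (F : finType) (h : T -> F) (P : {pred F}) :
  (forall o, measurable [set x | h x = o]) ->
  mu [set x | h x \in P] = (\sum_(o in P) mu [set x | h x = o])%E.
Proof.
move=> mh.
have -> : [set x | h x \in P] = \bigcup_(o in [set` P]) [set x | h x = o].
  apply/seteqP; split=> [x Px|x [y Py xy]]; last by rewrite /= xy.
  by exists (h x).
rewrite measure_fin_bigcup/=; last 3 first.
- exact: finite_finset.
- by move=> o o' _ _ [x [xo xo']]; rewrite -xo -xo'.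
- by move=> o _; exact: mh.
rewrite (fsbigE (enum P)) ?enum_uniq//=.
- by rewrite big_enum_cond/=; apply: eq_bigl => o; rewrite mem_setE andbb.
- by move=> o /=; rewrite mem_enum.
- by move=> o /= Po; rewrite mem_enum Po.
Qed.

End fin_partition.

Lemma probability_fibers d (T : measurableType d) (R : realType)
    (mu : probability T R) (F : finType) (h : T -> F) :
  (forall o, measurable [set x | h x = o]) ->
  (\sum_o mu [set x | h x = o])%E = 1%E.
Proof.
move=> mh; rewrite -(@probability_setT _ _ _ mu).
have -> : setT = [set x | h x \in predT] by apply/seteqP; split.
by rewrite (measure_preimage_fin mu _ mh).
Qed.

Section coordinate.
Context (R : realType) (N : nat) (s : avalanche_system R N) (i : 'I_N).
Hypothesis sat : tower_saturated s.

Let mu := coord_prob s i.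
Let U : set (borelType (Defs.space s i)) := top s i.
Let T : borelType (Defs.space s i) -> borelType (Defs.space s i) := coord_map s i.

Lemma measurable_coord_map : measurable_fun setT T.
Proof.
apply: (@measurability _ _ _ (borelType (Defs.space s i)) _ _ 
  (@open (Defs.space s i))) => // _ [V oV <-].
rewrite setTI; apply: sub_sigma_algebra.
by apply: open_comp => // x _; exact: coord_map_continuous.
Qed.

Lemma measurable_iter (n : nat) (A : set (borelType (Defs.space s i))) :
  measurable A -> measurable (iter n T @^-1` A).
Proof.
move=> mA; elim: n => [//|n IHn].
rewrite [X in measurable X](_ : _ = T @^-1` (iter n T @^-1` A)); last first.
  by apply/seteqP; split=> x /=; rewrite -iterSr.
by rewrite -[X in measurable X]setTI; exact: measurable_coord_map.
Qed.

Lemma iter_invariant (n : nat) (A : set (borelType (Defs.space s i))) :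
  measurable A -> mu (iter n T @^-1` A) = mu A.
Proof.
move=> mA; elim: n => [//|n IHn].
rewrite -[RHS]IHn -(coord_prob_invariant (measurable_iter n mA)).
by congr (mu _); apply/seteqP; split=> x /=; rewrite -iterSr.
Qed.

Lemma measurable_top : measurable U.
Proof. by apply: sub_sigma_algebra; exact: top_open. Qed.

Lemma iter_negligible (n : nat) (A : set (borelType (Defs.space s i))) :
  mu.-negligible A -> mu.-negligible (iter n T @^-1` A).
Proof.
move=> [B [mB B0 AB]]; exists (iter n T @^-1` B); split.
- exact: measurable_iter.
- by rewrite iter_invariant.
- by move=> x /AB.
Qed.

(** The measure is pulled back by the n-th iterate, n being the height. If x and
    its d-th image y both reach U after n steps, then, up to a null set,
    saturation puts both in the base; as y also lies on the level d of the
    tower, this contradicts the disjointness of the levels. *)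
Lemma return_negligible (d : nat) : (0 < d <= N)%N ->
  mu (U `&` iter d T @^-1` U) = 0%E.
Proof.
move=> /andP[d0 dN].
have mU := measurable_top; set n := height s i.
have dn : (d <= n)%N by apply: leq_trans dN _; rewrite -ltnS; exact: height_gt.
rewrite -(@iter_invariant n); last by apply: measurableI => //;
  exact: measurable_iter.
apply: measure_negligible.
  by apply: measurable_iter; apply: measurableI => //;
  exact: measurable_iter.
pose E := (iter n T @^-1` U) `\` base s i.
apply: (@negligibleS _ _ _ _ (E `|` iter d T @^-1` E)); last first.
  by apply: negligibleU; [|apply: iter_negligible]; exact: sat.
move=> x [/= Ux Udx].
have [Bx|nBx] := pselect (base s i x); last by left.
right; split; first by rewrite /= -iterD addnC iterD.
move=> Bdx; have [/trivIsetP triv _] := towerP s i.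
have : (0 != d)%N by rewrite eq_sym -lt0n.
move/(triv 0%N d (leq0n n) dn)/seteqP => -[+ _] => /(_ (iter d T x)); apply.
by split; [exists (iter d T x)|exists x].
Qed.

Lemma return_time_negligible (k l : nat) : (k < l <= N)%N ->
  mu ((iter k T @^-1` U) `&` (iter l T @^-1` U)) = 0%E.
Proof.
move=> /andP[kl lN]; have mU := measurable_top.
rewrite -[RHS](@return_negligible (l - k)); last first.
  by rewrite subn_gt0 kl (leq_trans (leq_subr _ _)).
rewrite -[RHS](@iter_invariant k); last by apply: measurableI => //;
  exact: measurable_iter.
congr (mu _); apply/seteqP; split=> x /=; by rewrite -iterD subnK// ltnW.
Qed.

Variable a : nat.
Hypothesis aN : (a <= N)%N.

Definition coord_hit (x : borelType (Defs.space s i)) : option 'I_a.+1 :=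
  first_hit a (fun l => U (iter l T x)).

Lemma coord_hit_SomeE (l : 'I_a.+1) :
  [set x | coord_hit x = Some l] =
  (iter l T @^-1` U) `\` \bigcup_(k in `I_l) (iter k T @^-1` U).
Proof.
apply/seteqP; split=> x /=.
  by move/first_hit_Some => [Ul min]; split=> // -[k /= kl]; exact: min.
by move=> [Ul nU]; apply/first_hit_Some; split=> // k kl Uk; apply: nU; exists k.
Qed.

Lemma coord_hit_NoneE :
  [set x | coord_hit x = None] = ~` \bigcup_(k in `I_a.+1) (iter k T @^-1` U).
Proof.
apply/seteqP; split=> x /=.
  by move/first_hit_None => nU [k /= ka]; exact: nU.
by move=> nU; apply/first_hit_None => k ka Uk; apply: nU; exists k.
Qed.

Lemma measurable_hit_before (l : nat) :
  measurable (\bigcup_(k in `I_l) (iter k T @^-1` U)).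
Proof. by apply: bigcup_measurable => k _; apply: measurable_iter; exact: measurable_top. Qed.

Lemma measurable_coord_hit o : measurable [set x | coord_hit x = o].
Proof.
case: o => [l|].
  rewrite coord_hit_SomeE; apply: measurableD; last exact: measurable_hit_before.
  by apply: measurable_iter; exact: measurable_top.
by rewrite coord_hit_NoneE; apply: measurableC; exact: measurable_hit_before.
Qed.

(** A first hit at time l is a hit at time l, up to the null set of points that
    hit twice; the law of the hitting times is therefore uniform by invariance. *)
Lemma coord_hit_Some (l : 'I_a.+1) : mu [set x | coord_hit x = Some l] = mu U.
Proof.
rewrite coord_hit_SomeE -[RHS](@iter_invariant l); last exact: measurable_top.
have ml := measurable_iter l measurable_top.
rewrite [RHS](measureDI mu ml (measurable_hit_before l)).
rewrite [X in _ = (_ + X)%E](_ : _ = 0%E) ?adde0//.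
apply: measure_negligible; first by apply: measurableI => //; exact: measurable_hit_before.
rewrite setI_bigcupr bigcup_mkcond; apply: negligible_bigcup => k.
case: ifPn => [|_]; last exact: negligible_set0.
rewrite inE /= => kl; apply/negligibleP.
  by apply: measurableI => //; apply: measurable_iter; exact: measurable_top.
rewrite setIC; apply: return_time_negligible.
by rewrite kl (leq_trans _ aN)// leq_ord.
Qed.

Lemma coord_hit_None (p : R) : mu U = p%:E ->
  mu [set x | coord_hit x = None] = (1 - a.+1%:R * p)%:E.
Proof.
move=> Up.
have := probability_fibers mu measurable_coord_hit.
rewrite (bigD1 None)//= (eq_bigr (fun=> p%:E)); last first.
  by case=> // l _; rewrite coord_hit_Some.
rewrite sumEFin (sumr_const (predC1 None)) cardC1 card_option card_ord/=.
set none := (X in (X + _)%E = _ -> _) => h.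
rewrite [LHS](_ : _ = none)//; case: none h => [r| |]//= -[h].
by apply/eqP; rewrite eqe mulr_natl eq_sym subr_eq h.
Qed.

End coordinate.

(** * The law of the avalanche size *)

Section avalanche_law.
Context (R : realType) (N : nat) (s : avalanche_system R N).
Hypothesis sat : tower_saturated s.
Variable p : R.
Hypothesis topp : forall i, coord_prob s i (top s i) = p%:E.
Variable a : nat.
Hypothesis aN : (a <= N)%N.

Let code (x : prodType (Defs.space s)) := hitting_code x a.

Lemma code_fiberE (f : {ffun 'I_N -> option 'I_a.+1}) :
  [set x | code x = f] =
  [set x | forall i, [set y | @coord_hit R N s i a y = f i] (x i)].
Proof.
apply/seteqP; split=> x /= xf.
  by move=> i; rewrite -xf ffunE.
by apply/ffunP => i; rewrite ffunE; exact: xf.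
Qed.

Lemma measurable_code f : measurable [set x | code x = f].
Proof.
rewrite code_fiberE.
rewrite [X in measurable X](_ : _ = \bigcap_(i in [set: 'I_N])
  ((fun x : prodType (Defs.space s) => x i) @^-1`
     [set y | @coord_hit R N s i a y = f i])); last first.
  by apply/seteqP; split=> x /= xf i => [_|]; exact: xf.
apply: fin_bigcap_measurable => [|i _]; first exact: finite_finset.
apply: sub_sigma_algebra; exists i => //.
exists [set y | @coord_hit R N s i a y = f i]; first exact: measurable_coord_hit.
by rewrite setTI.
Qed.

(** All codes with a hits have the same probability, which is why counting them
    is enough. *)
Lemma code_prob (f : {ffun 'I_N -> option 'I_a.+1}) : count_upto f a = a ->
  prod_prob s [set x | code x = f] =
  (p ^+ a * (1 - a.+1%:R * p) ^+ (N - a))%:E.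
Proof.
move=> fa; rewrite code_fiberE.
rewrite (@prod_probP R N s (fun i => [set y | @coord_hit R N s i a y = f i])
  (fun i => measurable_coord_hit (f i))).
rewrite (eq_bigr (fun i => (if f i then p else 1 - a.+1%:R * p)%:E)); last first.
  move=> i _; case: (f i) => [l|]; last exact: coord_hit_None.
  by rewrite coord_hit_Some.
rewrite prodEFin; congr EFin.
rewrite (bigID (fun i => isSome (f i)))/=.
have cardS : #|[pred i | isSome (f i)]| = a.
  rewrite -[RHS]fa; apply: eq_card => i; rewrite !inE.
  by case: (f i) => //= l; rewrite leq_ord.
congr (_ * _).
  rewrite (eq_bigr (fun=> p)) => [|i -> //].
  by rewrite (prodr_const [pred i | isSome (f i)]) cardS.
rewrite (eq_bigr (fun=> 1 - a.+1%:R * p)) => [|i /negPf -> //].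
rewrite (prodr_const [predC [pred i | isSome (f i)]]); congr (_ ^+ _).
by rewrite -[N in RHS]card_ord -(cardC [pred i | isSome (f i)]) cardS addKn.
Qed.

Lemma avalanche_law :
  avalanche_prob s a = #|[pred f : {ffun 'I_N -> option 'I_a.+1} | parking f]|%:R *
    (p ^+ a * (1 - a.+1%:R * p) ^+ (N - a)).
Proof.
rewrite /avalanche_prob.
rewrite [X in prod_prob s X](_ : _ =
    [set x | code x \in [pred f | parking f]]); last first.
  apply/seteqP; split=> x /=; rewrite inE; last exact: (avalanche_parking x a).2.
  exact: (avalanche_parking x a).1.
rewrite measure_preimage_fin; last exact: measurable_code.
rewrite (eq_bigr (fun=> (p ^+ a * (1 - a.+1%:R * p) ^+ (N - a))%:E)).
  by rewrite sumEFin sumr_const/= [RHS]mulr_natl.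
by move=> f; rewrite inE => /andP[/eqP fa _]; exact: code_prob.
Qed.

(** The factor (a + 1)^(a - 1) is written (a + 1)^a / (a + 1). *)
Lemma avalanche_law_bin :
  avalanche_prob s a = 'C(N, a)%:R * a.+1%:R ^+ a / a.+1%:R *
    (p ^+ a * (1 - a.+1%:R * p) ^+ (N - a)).
Proof.
rewrite avalanche_law; congr (_ * _).
rewrite -natrX -natrM -card_parking natrM mulrAC divff ?mul1r//.
Qed.

End avalanche_law.

(** * Limits and bounds for logarithms *)

Section log_asymptotics.
Context {R : realType}.
Implicit Types (c x : R).

Lemma cvg_div_nat c : c / n%:R @[n --> \oo] --> (0 : R).
Proof.
rewrite -(cvg_shiftS (fun n => c / n%:R)).
by have := @cvgMr _ _ _ _ _ c _ (@cvg_harmonic R); rewrite mulr0; exact.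
Qed.

Lemma cvg_ln1B_div c : ln (1 - c / n%:R) @[n --> \oo] --> (0 : R).
Proof.
rewrite -ln1; apply: continuous_cvg; first exact: continuous_ln.
by have := cvgB (cvg_cst (1 : R)) (@cvg_div_nat c); rewrite subr0; exact.
Qed.

(** Squeezed by the inequalities 1 - 1/y <= ln y <= y - 1 at y = 1 - c/n. *)
Lemma cvg_mul_ln1B_div c :
  0 < c -> n%:R * ln (1 - c / n%:R) @[n --> \oo] --> - c.
Proof.
move=> c0.
apply: (@squeeze_cvgr _ _ _ _ (fun n => - (c / (1 - c / n%:R))) (fun=> - c)).
- have small : \forall n \near \oo, c / n%:R < 1 :> R.
    exact: (cvgr_lt (0 : R) (@cvg_div_nat c)).
  near=> n.
  have n0 : 0 < n%:R :> R by rewrite ltr0n; near: n; exact: nbhs_infty_gt.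
  have cn : c / n%:R < 1 by near: n.
  set y := 1 - c / n%:R; have y0 : 0 < y by rewrite subr_gt0.
  have cE : c = n%:R * (1 - y) by rewrite /y; field; exact: lt0r_neq0.
  have lnub : ln y <= y - 1.
    by have := @le_ln1Dx _ (y - 1); rewrite addrCA subrr addr0; apply; lra.
  have lnlb : 1 - y^-1 <= ln y.
    have yV0 : 0 < y^-1 by rewrite invr_gt0.
    have := @le_ln1Dx _ (y^-1 - 1); rewrite addrCA subrr addr0 lnV//.
    by have -> : -1 < y^-1 - 1 by [lra]; move=> /(_ isT); lra.
  apply/andP; split; last by rewrite [in leRHS]cE -mulrN ler_pM2l//; lra.
  rewrite [X in - (X / _)]cE -mulrA -mulrN ler_pM2l//.
  apply: le_trans lnlb; rewrite mulrBl mul1r divff ?lt0r_neq0//; lra.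
- have := cvgB (cvg_cst (1 : R)) (@cvg_div_nat c); rewrite subr0.
  move=> /(_ _ _) h; have := cvgN (@cvgMr _ _ _ _ _ c _ (cvgV (oner_neq0 R) h)).
  by rewrite invr1 mulr1; exact.
- exact: cvg_cst.
Unshelve. all: end_near.
Qed.

Lemma cvg_mul_sub_ln1B_div c (a : nat) :
  0 < c -> (n - a)%:R * ln (1 - c / n%:R) @[n --> \oo] --> - c.
Proof.
move=> c0.
have := cvgB (cvg_mul_ln1B_div c0) (@cvgMr _ _ _ _ _ a%:R _ (@cvg_ln1B_div c)).
rewrite mulr0 subr0 => /(_ _ _) h; apply: cvg_trans h.
apply: near_eq_cvg; near=> n; rewrite natrB ?mulrBl//.
by near: n; exact: nbhs_infty_ge.
Unshelve. all: end_near.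
Qed.

Lemma ge0_derive_ge_at1 (f f' : R -> R) (x : R) : 1 <= x ->
  (forall y : R, 1 <= y -> is_derive y 1 f (f' y)) ->
  (forall y : R, 1 <= y -> 0 <= f' y) -> f 1 <= f x.
Proof.
move=> x1 df f'0.
have d (y : R) : 1 <= y -> derivable f y 1 
  by move=> y1; exact: (@ex_derive _ _ _ _ _ _ _ (df y y1)).
apply: (@ger0_derive1_le_cc _ f 1 x) => //.
- by move=> y /[!in_itv]/= /andP[/ltW /d].
- move=> y /[!in_itv]/= /andP[/ltW y1 _].
  by rewrite derive1E (@derive_val _ _ _ _ _ _ _ (df y y1)) f'0.
- apply: derivable_within_continuous => y /[!in_itv]/= /andP[y1 _].
  exact: d.
- by rewrite in_itv/= lexx.
- by rewrite in_itv/= x1 lexx.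
Qed.

(** In the variable t = ln x this reads t <= sinh t. The difference of the two
    sides has derivative (1 - 1/x)^2 / 2. *)
Lemma le_ln_sinh x : 1 <= x -> ln x <= (x - x^-1) / 2.
Proof.
move=> x1; rewrite -subr_ge0 mulrC.
pose f y : R := 2^-1 * (y - y^-1) - ln y.
have -> : 0 = f 1 by rewrite /f ln1 invr1; lra.
rewrite -/(f x).
apply: (@ge0_derive_ge_at1 f (fun y => 2^-1 * (1 - y^-1) ^+ 2) x x1) => y y1; last first.
  by rewrite mulr_ge0 ?sqr_ge0// invr_ge0.
have y0 : 0 < y by lra.
have dV := is_deriveV (lt0r_neq0 y0) (is_derive_id y (1 : R)).
apply: (@is_derive_eq _ _ _ _ _ _ _ _
  (is_deriveB (is_deriveZ 2^-1 (is_deriveB (is_derive_id y (1 : R)) dV))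
              (is_derive1_ln y0))).
by rewrite /GRing.scale/=; field; exact: lt0r_neq0.
Qed.

(** In the variable t = ln x this reads 2 tanh (t / 2) <= t. The difference of the
    two sides has derivative (x - 1)^2 / (x (x + 1)^2). *)
Lemma ge_ln_tanh x : 1 <= x -> 2 * (x - 1) / (x + 1) <= ln x.
Proof.
move=> x1.
have -> : 2 * (x - 1) / (x + 1) = 2 - 4 * (x + 1)^-1.
  by field; rewrite lt0r_neq0//; lra.
rewrite -subr_ge0.
pose f y : R := ln y - (2 - 4 * (y + 1)^-1).
have -> : 0 = f 1 by rewrite /f ln1; field.
rewrite -/(f x).
apply: (@ge0_derive_ge_at1 f (fun y => (y - 1) ^+ 2 / (y * (y + 1) ^+ 2)) x x1) => y y1;
  last first.
  by rewrite divr_ge0 ?sqr_ge0 ?mulr_ge0 ?sqr_ge0//; lra.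
have y0 : 0 < y by lra.
have y10 : 0 < y + 1 by lra.
have dV : is_derive y (1 : R) (fun z : R => (z + 1)^-1) (- (y + 1) ^- 2 * (1 + 0)).
  exact: (@is_deriveV _ (id + cst (1 : R)) y _ _ (lt0r_neq0 y10)
    (is_deriveD (is_derive_id y (1 : R)) (is_derive_cst (1 : R) y (1 : R)))).
apply: (@is_derive_eq _ _ _ _ _ _ _ _
  (is_deriveB (is_derive1_ln y0)
              (is_deriveB (is_derive_cst (2 : R) y (1 : R)) (is_deriveZ 4 dV)))).
by rewrite /GRing.scale/=; field; rewrite !lt0r_neq0.
Qed.

(** The logarithm of b a / b (a + 1), where b is the limit of the
    avalanche laws for p = alpha / N, b a = (a + 1)^(a - 1) alpha^a exp (- (a + 1) alpha) / a!. *)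
Definition log_ratio (alpha : R) (a : nat) : R :=
  a%:R * ln (a.+1%:R / a.+2%:R) + alpha - ln alpha.

Definition critical_log_ratio (a : nat) : R :=
  a%:R * ln (a.+1%:R / a.+2%:R) + 1.

Lemma cvg_log_ratio (a : nat) :
  log_ratio alpha a @[alpha --> 1^'-] --> critical_log_ratio a.
Proof.
apply: cvg_at_left_filter.
have ln1 : ln x @[x --> (1 : R)] --> ln (1 : R) by exact: continuous_ln.
have id1 : x @[x --> (1 : R)] --> (1 : R) by exact: cvg_id.
have := cvgB (cvgD (cvg_cst (a%:R * ln (a.+1%:R / a.+2%:R))) id1) ln1.
by rewrite exp.ln1 subr0; exact.
Qed.

(** At x = (t + 2) / (t + 1) the inequalities [ge_ln_tanh] and [le_ln_sinh] enclose
    1 - t ln x between (3 t + 4) / (2 (t + 1) (t + 2)) and 3 / (2 t + 3); both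
    bounds agree with 3 / (2 t) up to O(1 / t^2). *)
Lemma critical_log_ratio_bound (t : R) : 0 < t ->
  `|1 - t * ln ((t + 2) / (t + 1)) - 3 / (2 * t)| <= 5 / t * t^-1.
Proof.
move=> t0.
have u1 : 1 <= (t + 2) / (t + 1) by rewrite ler_pdivlMr; lra.
have := le_ln_sinh u1; have := ge_ln_tanh u1; move: (ln _) => l lb ub.
have {}lb : t * (2 / (2 * t + 3)) <= t * l.
  rewrite ler_pM2l//; apply: le_trans lb; rewrite le_eqVlt; apply/orP; left.
  by apply/eqP; field; rewrite !lt0r_neq0//; lra.
have {}ub : t * l <= t * ((2 * t + 3) / (2 * (t + 1) * (t + 2))).
  rewrite ler_pM2l//; apply: le_trans ub _; rewrite le_eqVlt; apply/orP; left.
  by apply/eqP; field; rewrite !lt0r_neq0//; lra.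
have lbE : 5 / t * t^-1 - (1 - t * (2 / (2 * t + 3)) - 3 / (2 * t)) =
    (29 * t + 30) / (2 * t ^+ 2 * (2 * t + 3)).
  by field; rewrite !lt0r_neq0//; lra.
have ubE : 5 / t * t^-1 +
    (1 - t * ((2 * t + 3) / (2 * (t + 1) * (t + 2))) - 3 / (2 * t)) =
    (5 * t ^+ 2 + 24 * t + 20) / (2 * t ^+ 2 * (t + 1) * (t + 2)).
  by field; rewrite !lt0r_neq0//; lra.
have t2 : 0 < t ^+ 2 by rewrite exprn_gt0.
have lb0 : 0 <= (29 * t + 30) / (2 * t ^+ 2 * (2 * t + 3)).
  by rewrite divr_ge0// ?mulr_ge0//; lra.
have ub0 : 0 <= (5 * t ^+ 2 + 24 * t + 20) / (2 * t ^+ 2 * (t + 1) * (t + 2)).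
  by rewrite divr_ge0// ?mulr_ge0//; lra.
rewrite -lbE in lb0; rewrite -ubE in ub0.
by rewrite ler_norml; apply/andP; split; lra.
Qed.

Lemma critical_log_ratio_littleo :
  ((fun a => critical_log_ratio a - 3 / (2 * a%:R)) : nat -> R^o)
    =o_\oo ((fun a => a%:R^-1) : nat -> R^o).
Proof.
apply/eqoP => e e0; near=> a.
have a0 : 0 < a%:R :> R by rewrite ltr0n; near: a; exact: nbhs_infty_gt.
have ea : 5 / a%:R < e :> R.
  by near: a; exact: (cvgr_lt (0 : R) (@cvg_div_nat 5)).
rewrite /= [leRHS](_ : _ = e * a%:R^-1); last by rewrite gtr0_norm ?invr_gt0.
have aV0 : 0 < a%:R^-1 :> R by rewrite invr_gt0.
apply: (@le_trans _ _ (5 / a%:R * a%:R^-1)); last by rewrite ler_pM2r// ltW.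
apply: le_trans (critical_log_ratio_bound a0); rewrite le_eqVlt; apply/orP; left.
rewrite /critical_log_ratio -invf_div lnV ?posrE ?divr_gt0 ?ltr0n//.
have a2 : a.+2%:R = a%:R + 2 :> R by rewrite -addn2 natrD.
by rewrite mulrN [- _ + 1]addrC a2 -[a.+1%:R]natr1.
Unshelve. all: end_near.
Qed.

End log_asymptotics.

(** * The limit of the logarithmic ratios *)

Section limit.
Context (R : realType) (s : forall N, avalanche_system R N) (alpha : R).
Hypothesis sat : forall N, tower_saturated (s N).
Hypothesis alpha0 : 0 < alpha.
Hypothesis stop : \forall N \near \oo, forall i : 'I_N,
  coord_prob (s N) i (top (s N) i) = (alpha / N%:R)%:E.

Lemma ln_avalanche_ratio (N a : nat) (p : R) : (a < N)%N -> 0 < p ->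
  0 < 1 - a.+2%:R * p ->
  (forall i, coord_prob (s N) i (top (s N) i) = p%:E) ->
  ln (avalanche_prob (s N) a / avalanche_prob (s N) a.+1) =
  a%:R * ln (a.+1%:R / a.+2%:R) - ln ((N - a)%:R * p)
  + (N - a)%:R * ln (1 - a.+1%:R * p) - (N - a.+1)%:R * ln (1 - a.+2%:R * p).
Proof.
move=> aN p0 q0 topp.
have q1 : 0 < 1 - a.+1%:R * p.
  by apply: lt_le_trans q0 _; rewrite lerD2l lerN2 ler_pM2r// ler_nat.
rewrite !(avalanche_law_bin (@sat N) topp)//; last exact: ltnW.
set q := 1 - a.+1%:R * p in q1 *; set r := 1 - a.+2%:R * p in q0 *.
have n1 : a.+1%:R != 0 :> R by rewrite pnatr_eq0.
have n2 : a.+2%:R != 0 :> R by rewrite pnatr_eq0.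
have nb : 'C(N, a.+1)%:R != 0 :> R by rewrite pnatr_eq0 -lt0n bin_gt0.
have nd : (N - a)%:R != 0 :> R by rewrite pnatr_eq0 -lt0n subn_gt0.
have binE : 'C(N, a)%:R = a.+1%:R * 'C(N, a.+1)%:R / (N - a)%:R :> R.
  by rewrite -natrM mul_bin_left natrM mulrAC divff ?mul1r.
rewrite [X in ln X](_ : _ = (a.+1%:R / a.+2%:R) ^+ a * ((N - a)%:R * p)^-1 *
    q ^+ (N - a) * (r ^+ (N - a.+1))^-1); last first.
  rewrite binE expr_div_n !exprS; clearbody q r.
  (* The casts are made opaque, since field would otherwise unfold successors. *)
  move: n1 n2 nb nd; move: (a.+1%:R) (a.+2%:R) (N - a)%:R 'C(N, a.+1)%:R.
  move=> x y z b x0 y0 b0 z0; field.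
  by rewrite x0 y0 b0 z0 (lt0r_neq0 p0) !expf_neq0// lt0r_neq0.
have d0 : 0 < (N - a)%:R * p by rewrite mulr_gt0// ltr0n subn_gt0.
have h0 : 0 < a.+1%:R / a.+2%:R :> R by rewrite divr_gt0// ltr0n.
set h := a.+1%:R / a.+2%:R in h0 *; set d := (N - a)%:R * p in d0 *.
have Q0 : 0 < q ^+ (N - a) by rewrite exprn_gt0.
have R0 : 0 < r ^+ (N - a.+1) by rewrite exprn_gt0.
have H0 : 0 < h ^+ a by rewrite exprn_gt0.
rewrite ln_div ?posrE ?mulr_gt0 ?invr_gt0// lnM ?posrE ?mulr_gt0 ?invr_gt0//.
by rewrite ln_div ?posrE// !lnXn// !mulr_natl.
Qed.

(** In [ln_avalanche_ratio] with p = alpha / N, the second term tends to ln alpha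
    and the last two terms tend to - (a + 1) alpha and - (a + 2) alpha. *)
Lemma cvg_ln_avalanche_ratio (a : nat) :
  ln (avalanche_prob (s N) a / avalanche_prob (s N) a.+1) @[N --> \oo]
    --> log_ratio alpha a.
Proof.
have c0 k : 0 < k.+1%:R * alpha by rewrite mulr_gt0// ltr0n.
have cvgd : ln ((N - a)%:R * (alpha / N%:R)) @[N --> \oo] --> ln alpha.
  apply: continuous_cvg; first exact: continuous_ln.
  have := cvgB (cvg_cst alpha) (@cvg_div_nat R (a%:R * alpha)).
  rewrite subr0 => /(_ _ _) h; apply: cvg_trans h; apply: near_eq_cvg; near=> N.
  have N0 : N%:R != 0 :> R.
    by rewrite pnatr_eq0 -lt0n; near: N; exact: nbhs_infty_gt.
  rewrite natrB; last by near: N; exact: nbhs_infty_ge.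
  by rewrite /= !fctE; field.
have := cvgB (cvgD (cvgB (cvg_cst (a%:R * ln (a.+1%:R / a.+2%:R))) cvgd)
    (cvg_mul_sub_ln1B_div a (c0 a)))
  (cvg_mul_sub_ln1B_div a.+1 (c0 a.+1)).
move=> /(_ _ _ _ _ _ _) h.
have -> : log_ratio alpha a = a%:R * ln (a.+1%:R / a.+2%:R) - ln alpha +
    - (a.+1%:R * alpha) - - (a.+2%:R * alpha).
  by rewrite /log_ratio -[a.+2%:R]natr1; ring.
apply: cvg_trans h; apply: near_eq_cvg; near=> N.
have N0 : (0 < N)%N by near: N; exact: nbhs_infty_gt.
have p0 : 0 < alpha / N%:R by rewrite divr_gt0// ltr0n.
rewrite (@ln_avalanche_ratio _ _ (alpha / N%:R))//.
- by rewrite !fctE !mulrA.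
- by near: N; exact: nbhs_infty_gt.
- rewrite mulrA subr_gt0; near: N.
  exact: (cvgr_lt (0 : R) (@cvg_div_nat R (a.+2%:R * alpha))).
- by near: N; exact: stop.
Unshelve. all: end_near.
Qed.

End limit.

Theorem mainTheorem4 (R : realType)
  (sys : R -> forall N : nat, avalanche_system R N)
  (sys_saturated : forall (alpha : R) (N : nat),
    tower_saturated (sys alpha N))
  (sys_top : forall alpha : R, 0 < alpha < 1 -> \forall N \near \oo,
    forall i : 'I_N,
      coord_prob (sys alpha N) i (top (sys alpha N) i)
        = (alpha / N%:R)%:E) :
  exists2 l : R -> nat -> R,
    (forall alpha : R, 0 < alpha < 1 -> forall a : nat, (0 < a)%N ->
      ln (avalanche_prob (sys alpha N) a / avalanche_prob (sys alpha N) a.+1)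
        @[N --> \oo] --> l alpha a) &
  exists2 L : nat -> R,
    (forall a : nat, (0 < a)%N -> l alpha a @[alpha --> 1^'-] --> L a) &
    ((fun a : nat => L a - 3 / (2 * a%:R)) : nat -> R^o)
      =o_\oo ((fun a : nat => a%:R^-1) : nat -> R^o).
Proof.
exists (@log_ratio R) => [alpha alpha01 a _|].
  apply: cvg_ln_avalanche_ratio => //; last exact: sys_top.
  by case/andP: alpha01.
exists (@critical_log_ratio R); last exact: critical_log_ratio_littleo.
by move=> a _; exact: cvg_log_ratio.
Qed.
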